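(* Let $S$ be an $n\times n$ Hermitian matrix with spectrum $\lambda_1<\dots<\lambda_n$, an eigenbasis $\mathcal{Q}$ and positive orthant $\mathcal{O}_Q$. 1. Say the entries of $S$ lie in $\mathbb{K}=\mathbb{R}$ or $\mathbb{C}$, $v\in\mathbb{K}^n$. Then the maps $F:\mathcal{O}_Q\to\mathcal{P}_F$, $F(v)=\sigma_o(S+v\otimes v)$, and $G:\mathcal{O}_Q\times\mathbb{R}\to\mathcal{P}_G$, $G(v,c)=\sigma_o(T(v,c))$, extend to \[ \hat F:\mathbb{K}^n\to\mathcal{P}_F,\quad v\mapsto\sigma_o(S+v\otimes v),\qquad \hat G:\mathbb{K}^n\times\mathbb{R}\to\mathcal{P}_G,\quad (v,c)\mapsto\sigma_o(T(v,c)). \] Moreover, \[ \hat F(v)=\hat F(w)\ \Leftrightarrow\ \hat G(v,c)=\hat G(w,c)\ \Leftrightarrow\ \operatorname{abs}(v)=\operatorname{abs}(w). \] In particular, all preimages of a point belong to the same sphere $\mathcal{S}(r)$. 2. If $\mathbb{K}=\mathbb{R}$, a point $\mu\in\mathcal{P}_F$ (for $\hat G$, a point $\mu\in\mathcal{P}_G$) belonging to exactly $k$ faces of the polytope has $2^{n-k}$ preimages under $\hat F$ or $\hat G$, respectively. If $\mathbb{K}=\mathbb{C}$, for both functions the preimages of $\mu$ form a product of $n-k-1$ circles: a torus.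
   Context: $\mathbb{C}^n$ carries the Euclidean inner product $\langle\cdot,\cdot\rangle$, anti-linear in the second coordinate. For $v\in\mathbb{C}^n$, $v\otimes v=vv^\ast$ is the rank one map $u\mapsto\langle u,v\rangle v$. For $v\in\mathbb{C}^n$ and $c\in\mathbb{R}$, $T(v,c)$ is the bordered matrix \[ T(v,c)=\begin{pmatrix} S & v\\ v^\ast & c\end{pmatrix}. \] For a Hermitian matrix $A$, $\sigma_o(A)$ is the real vector whose entries are the eigenvalues of $A$ in nondecreasing order. $\mathcal{Q}=[q_1,\dots,q_n]$ is a fixed normalized eigenbasis of $S$, arranged as the columns of a unitary matrix $Q$. The positive orthant $\mathcal{O}_Q$ associated with $\mathcal{Q}$ is the set of vectors $Qp$ where $p\in\mathbb{R}^n$ has nonnegative entries. For $\mathbb{K}=\mathbb{R}$ or $\mathbb{C}$, the map $\operatorname{abs}:\mathbb{K}^n\to\mathcal{O}_Q$ is \[ v=\sum_{j=1}^n c_j\,q_j\ \mapsto\ \sum_{j=1}^n|c_j|\,q_j. \] The polytopes (half-open boxes) are \[ \mathcal{P}_F=[\lambda_1,\lambda_2]\times[\lambda_2,\lambda_3]\times\dots\times[\lambda_n,\infty)\subset\mathbb{R}^n, \] \[ \mathcal{P}_G=(-\infty,\lambda_1]\times[\lambda_1,\lambda_2]\times[\lambda_2,\lambda_3]\times\dots\times[\lambda_n,\infty)\subset\mathbb{R}^{n+1}; \] they have $2n-1$ and $2n$ (codimension one) faces, respectively. For $r>0$, $\mathcal{S}(r)=\{v\in\mathbb{C}^n:\|v\|=r\}$.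 The preimages of $y\in Y$ under a function $f:X\to Y$ are the points of $f^{-1}(y)=\{x\in X: f(x)=y\}$.
   Formalization: With d the number of repeated entries of μ, the preimages number 2^{n-k+d} for K=R and form a product of n-k+d circles for K=C (printed 2^{n-k} and n-k-1 circles are false in general); spheres S(r) allow r=0; for K=R the eigenbasis is real; for G the sphere contains the v-components. *)

(* Defs.v *)
From HB Require Import structures.
From mathcomp Require Import all_boot all_order all_algebra.
From mathcomp Require Import complex.
From mathcomp Require Import all_classical all_reals all_analysis.

Set Implicit Arguments.
Unset Strict Implicit.
Unset Printing Implicit Defensive.

Import Order.TTheory GRing.Theory Num.Theory.
Import numFieldNormedType.Exports.

Local Open Scope classical_set_scope.
Local Open Scope ring_scope.
Local Open Scope sesquilinear_scope.

(* The cast to numClosedFieldType gives R[i] the topology that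
   MathComp-Analysis puts on numeric fields. *)
Definition Cplx (R : realType) : numClosedFieldType := R[i].

Definition toC (R : realType) (x : R) : Cplx R := real_complex R x.

Definition reC (R : realType) (z : Cplx R) : R := complex.Re (z : R[i]).

Variant scalars := RealScalars | ComplexScalars.

(* For K = R, the vectors of K^n are the complex vectors with real entries. *)
Definition entries (R : realType) (K : scalars) : {pred Cplx R} :=
  match K with
  | RealScalars => [pred z : Cplx R | z \is Num.real]
  | ComplexScalars => predT
  end.
Arguments entries : clear implicits.

Definition Kvec (R : realType) (K : scalars) (n : nat) : set 'cV[Cplx R]_n :=
  [set v | forall i, v i 0 \in entries R K].
Arguments Kvec : clear implicits.

(* The norm that the library puts on matrices is the sup norm. *)
Definition enorm (R : realType) (n : nat) (v : 'cV[Cplx R]_n) : R :=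
  Num.sqrt (\sum_i reC `|v i 0| ^+ 2).

Definition sphere (R : realType) (n : nat) (r : R) : set 'cV[Cplx R]_n :=
  [set v | enorm v = r].

(* spectral_diag lists the eigenvalues with multiplicity; they are real when
   A is Hermitian, the only case in which sigma_o is meant to be used. *)
Definition sigma_o (R : realType) (m : nat) (A : 'M[Cplx R]_m) : m.-tuple R :=
  sort_tuple <=%O [tuple reC (spectral_diag A 0 i) | i < m].

Definition tensor (R : realType) (n : nat) (v : 'cV[Cplx R]_n) :
  'M[Cplx R]_n := v *m v^t*.

Definition bordered (R : realType) (n : nat) (S : 'M[Cplx R]_n)
    (v : 'cV[Cplx R]_n) (c : R) : 'M[Cplx R]_(n + 1) :=
  block_mx S v (v^t*) (toC c)%:M.

Definition hatF (R : realType) (n : nat) (S : 'M[Cplx R]_n)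
    (v : 'cV[Cplx R]_n) : n.-tuple R :=
  sigma_o (S + tensor v).

Definition hatG (R : realType) (n : nat) (S : 'M[Cplx R]_n)
    (vc : 'cV[Cplx R]_n * R) : (n + 1).-tuple R :=
  sigma_o (bordered S vc.1 vc.2).

Definition is_eigenbasis (R : realType) (n : nat) (S : 'M[Cplx R]_n)
    (lam : n.-tuple R) (Q : 'M[Cplx R]_n) : Prop :=
  Q \is unitarymx /\
  forall j, S *m col j Q = toC (tnth lam j) *: col j Q.

Definition orthant (R : realType) (n : nat) (Q : 'M[Cplx R]_n) :
  set 'cV[Cplx R]_n :=
  [set v | exists p : 'cV[R]_n,
     (forall i, 0 <= p i 0) /\ v = Q *m map_mx (@toC R) p].

(* invmx Q *m v is the vector of coordinates of v in the basis Q. *)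
Definition absQ (R : realType) (n : nat) (Q : 'M[Cplx R]_n)
    (v : 'cV[Cplx R]_n) : 'cV[Cplx R]_n :=
  Q *m map_mx (fun z => `|z|) (invmx Q *m v).

(* A pair (i, j) stands for the face of the box on which coordinate i equals
   lam_j.  Indices start from 0, so coordinate i of P_F ranges over
   [lam_i, lam_{i+1}] and coordinate i of P_G over [lam_{i-1}, lam_i]; a bound
   whose index is not in the range of lam is infinite. *)
Definition lower_faceF (n : nat) (i j : 'I_n) : bool := (i == j :> nat).
Definition upper_faceF (n : nat) (i j : 'I_n) : bool := (i.+1 == j :> nat).
Definition lower_faceG (n : nat) (i : 'I_(n + 1)) (j : 'I_n) : bool :=
  (i == j.+1 :> nat).
Definition upper_faceG (n : nat) (i : 'I_(n + 1)) (j : 'I_n) : bool :=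
  (i == j :> nat).

Definition polyF (R : realType) (n : nat) (lam : n.-tuple R) :
  set (n.-tuple R) :=
  [set x | forall i j,
     (lower_faceF i j -> tnth lam j <= tnth x i) /\
     (upper_faceF i j -> tnth x i <= tnth lam j)].

Definition polyG (R : realType) (n : nat) (lam : n.-tuple R) :
  set ((n + 1).-tuple R) :=
  [set x | forall i j,
     (lower_faceG i j -> tnth lam j <= tnth x i) /\
     (upper_faceG i j -> tnth x i <= tnth lam j)].

Definition facesF (n : nat) : {set 'I_n * 'I_n} :=
  [set ij | lower_faceF ij.1 ij.2 || upper_faceF ij.1 ij.2]%SET.

Definition facesG (n : nat) : {set 'I_(n + 1) * 'I_n} :=
  [set ij | lower_faceG ij.1 ij.2 || upper_faceG ij.1 ij.2]%SET.

Definition faces_throughF (R : realType) (n : nat) (lam mu : n.-tuple R) :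
  {set 'I_n * 'I_n} :=
  [set ij in facesF n | tnth mu ij.1 == tnth lam ij.2]%SET.

Definition faces_throughG (R : realType) (n : nat) (lam : n.-tuple R)
    (mu : (n + 1).-tuple R) : {set 'I_(n + 1) * 'I_n} :=
  [set ij in facesG n | tnth mu ij.1 == tnth lam ij.2]%SET.

(* The number of repeated entries of mu.  When lam is strictly increasing and
   mu is in P_F or P_G, an entry occurs at most twice in mu, and it occurs
   twice exactly when mu_i = lam_j = mu_{i+1} for some i, j: then mu is on two
   faces, although only one coordinate in the basis Q, the j-th, is zero. *)
Definition repeats (R : realType) (m : nat) (mu : m.-tuple R) : nat :=
  (size mu - size (undup mu))%N.

Definition homeomorphic (T U : topologicalType) (A : set T) (B : set U) :
  Prop :=
  exists (f : T -> U) (g : U -> T),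
    [/\ set_fun A B f, set_fun B A g,
        {in A, cancel f g}, {in B, cancel g f} &
        {within A, continuous f} /\ {within B, continuous g}].

Definition torus (R : realType) (m : nat) : set 'cV[Cplx R]_m :=
  [set z | forall i, `|z i 0| = 1].
Arguments torus : clear implicits.

(* Main.v *)
Require Import Defs.
From HB Require Import structures.
From mathcomp Require Import all_boot all_order all_fingroup all_algebra.
From mathcomp Require Import complex.
From mathcomp Require Import all_classical all_reals all_analysis.
From mathcomp Require Import zify.
Import Order.TTheory GRing.Theory Num.Theory.
Import numFieldNormedType.Exports.
Local Open Scope classical_set_scope.
Local Open Scope ring_scope.
Local Open Scope card_scope.
Set Implicit Arguments.
Unset Strict Implicit.
Unset Printing Implicit Defensive.

(** Both maps are governed by one polynomial identity.  Write x_j for the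
coordinates of v in the eigenbasis Q, P for prod_i (X - lambda_i) and P_j for
P / (X - lambda_j).  Conjugating by Q and expanding an arrow-shaped determinant
gives, for the characteristic polynomial of S + v v^* (with L = 1) and of
T(v, c) (with L = X - c),

   L P - sum_j |x_j|^2 P_j                                    (secular).

So the spectrum depends on v only through the numbers |x_j|^2, and it
determines them: evaluating at lambda_j leaves only - |x_j|^2 P_j(lambda_j),
while L is the quotient of the division by P ([weight_secular],
[divp_secular]).  This already gives the equivalences with abs(v) = abs(w).
Conversely, by Lagrange interpolation at the lambda_j, any monic real
polynomial p of degree n or n + 1 has the form above with suitable weights a_j
([secular_divp_weight]), where a_j = - p(lambda_j) / P_j(lambda_j).  The
weights are squared moduli as soon as they are nonnegative, and when p has
roots mu in the box a count of signs shows that they are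
([interlaces_weight_ge0]).

That the spectra do lie in the boxes is Cauchy interlacing.  It is derived from
the Courant-Fischer argument in the following form: fewer than p linear
conditions on C^p leave a nonzero vector, and prescribing that it avoids the
high eigenvectors of one matrix and the low eigenvectors of the other compares
the corresponding eigenvalues ([courant_fischer]).

Hence the preimages of mu form the set of v with |x_j| = sqrt(a_j) for all j
(together with a value of c that mu determines, for G).  Over R it has one sign
per nonzero a_j, over C one circle per nonzero a_j; and a_j = 0 exactly when
lambda_j is one of the mu_i.  Counting the incidences mu_i = lambda_j
identifies the number of nonzero a_j with n + repeats - k
([card_faces_repeats]).

The two boxes are treated together: with e = 0 for F and e = 1 for G,
coordinate i is bounded below by lambda_(i - e) and above by
lambda_(i + 1 - e), and mu has n + e entries. *)

(** * Determinants of arrow matrices and rank-one perturbations *)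

(** Multiplying on the right by a block matrix built from the diagonal matrix E
of partial products, for which D E is the scalar p, clears the last column
above the corner.  This avoids inverting D; p is cancelled at the end, and it
is also the determinant of the multiplier. *)
Lemma det_arrow (A : idomainType) n (d : 'rV[A]_n) (u : 'cV_n) (v : 'rV_n)
    (L : A) : \prod_i d 0 i != 0 ->
  \det (block_mx (diag_mx d) u v L%:M : 'M[A]_(n + 1)) =
  L * \prod_i d 0 i - \sum_j v 0 j * u j 0 * \prod_(i | i != j) d 0 i.
Proof.
move=> d0; set p := \prod_i d 0 i in d0 *.
pose E : 'M[A]_n := diag_mx (\row_j \prod_(i | i != j) d 0 i).
have DE : diag_mx d *m E = p%:M.
  rewrite /E mulmx_diag; apply/matrixP => i j; rewrite !mxE.
  case: (i == j); rewrite ?mulr0n ?mulr1n //.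
  by rewrite /p [RHS](bigD1 i).
pose N : 'M[A]_(n + 1) := block_mx 1%:M (- (E *m u)) 0 p%:M.
have detN : \det N = p by rewrite det_ublock det1 mul1r det_scalar expr1.
apply: (mulIf d0); rewrite -{1}detN -det_mulmx mulmx_block.
rewrite !mulmx1 !mulmx0 !addr0 !mulmxN mulmxA DE.
have -> : - (p%:M *m u) + u *m p%:M = 0 by rewrite scalar_mxC addNr.
rewrite det_lblock det_diag mulrC; congr (_ * _).
rewrite det_mx11 !mxE big_ord1 !mxE eqxx mulr1n addrC; congr (_ - _).
apply: eq_bigr => j _; rewrite -mulrA; congr (_ * _).
by rewrite mul_diag_mx !mxE mulrC.
Qed.

(** The case L = 1 of [det_arrow]: the Schur complement of the corner 1 is the
rank-one perturbation. *)
Lemma det_diag_rank1 (A : idomainType) n (d : 'rV[A]_n) (u : 'cV_n) (v : 'rV_n) :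
  \prod_i d 0 i != 0 ->
  \det (diag_mx d - u *m v) =
  \prod_i d 0 i - \sum_j v 0 j * u j 0 * \prod_(i | i != j) d 0 i.
Proof.
move=> /det_arrow -/(_ u v 1); rewrite mul1r => <-.
have := det_mulmx (block_mx (diag_mx d) u v 1%:M)
  (block_mx 1%:M 0 (- v) 1%:M : 'M[A]_(n + 1)).
rewrite mulmx_block !mulmx1 !mulmx0 !mul1mx add0r add0r subrr.
by rewrite mulmxN det_ublock det_lblock !det1 !mulr1.
Qed.

(** * The secular polynomial and Lagrange interpolation at the nodes *)

Section Secular.
Context {F : fieldType} {n : nat}.
Implicit Types (lam a : 'I_n -> F) (p L : {poly F}).

Definition nodal lam : {poly F} := \prod_i ('X - (lam i)%:P).

Definition secular lam a L : {poly F} :=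
  L * nodal lam - \sum_j a j *: \prod_(i | i != j) ('X - (lam i)%:P).

(** The Lagrange coefficients of - p at the nodes, that is
- p(lam_j) / nodal'(lam_j) when the nodes are distinct. *)
Definition weight lam p j : F := - p.[lam j] / \prod_(i | i != j) (lam j - lam i).

Lemma horner_secular lam a L j :
  (secular lam a L).[lam j] = - (a j * \prod_(i | i != j) (lam j - lam i)).
Proof.
have prodX (P : pred 'I_n) :
    (\prod_(i | P i) ('X - (lam i)%:P)).[lam j] = \prod_(i | P i) (lam j - lam i).
  by rewrite horner_prod; apply: eq_bigr => i _; rewrite hornerXsubC.
rewrite /secular /nodal hornerD hornerN hornerM prodX (bigD1 j) //= subrr mul0r.
rewrite mulr0 add0r horner_sum (bigD1 j) //= hornerZ prodX.
rewrite [X in _ + X]big1 ?addr0 // => i ij.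
by rewrite hornerZ prodX (bigD1 j) 1?eq_sym //= subrr mul0r mulr0.
Qed.

Lemma prod_neq_sub_neq0 lam j : injective lam ->
  \prod_(i | i != j) (lam j - lam i) != 0.
Proof.
move=> lam_inj; apply/prodf_neq0 => i ij.
by rewrite subr_eq0 (inj_eq lam_inj) eq_sym.
Qed.

Lemma weight_secular lam a L : injective lam ->
  weight lam (secular lam a L) =1 a.
Proof.
move=> lam_inj j; rewrite /weight horner_secular opprK mulfK //.
exact: prod_neq_sub_neq0.
Qed.

Lemma size_nodal lam : size (nodal lam) = n.+1.
Proof.
rewrite size_prod_XsubC -[index_enum _]filter_predT.
by rewrite deprecated_filter_index_enum -cardE card_ord.
Qed.

Lemma nodal_monic lam : nodal lam \is monic.
Proof. exact: monic_prod_XsubC. Qed.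

Lemma size_partial lam a :
  (size (\sum_j a j *: \prod_(i | i != j) ('X - (lam i)%:P))%R <
     size (nodal lam))%N.
Proof.
rewrite size_nodal ltnS (leq_trans (size_sum _ _ _)) //; apply/bigmax_leqP => j _.
rewrite (leq_trans (size_scale_leq _ _)) // -ltnS -(size_nodal lam) /nodal.
rewrite [X in (_ <= size (polyseq X))%N](bigD1 j) //= size_Mmonic ?monic_prod_XsubC //.
  by rewrite size_XsubC.
by rewrite polyXsubC_eq0.
Qed.

Lemma divp_secular lam a L : secular lam a L %/ nodal lam = L.
Proof.
by rewrite divp_addl_mul_small ?monic_neq0 ?nodal_monic ?size_polyN ?size_partial.
Qed.

(** Both sides agree at the n nodes, and they have the same quotient by the
nodal polynomial, so their difference has degree less than n. *)
Lemma secular_divp_weight lam p : injective lam ->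
  secular lam (weight lam p) (p %/ nodal lam) = p.
Proof.
move=> lam_inj; apply/esym/eqP; rewrite -subr_eq0; apply/eqP.
apply: (@roots_geq_poly_eq0 _ _ (codom lam)).
- apply/allP => _ /codomP[j ->]; rewrite /root hornerD hornerN horner_secular.
  by rewrite opprK /weight divfK ?prod_neq_sub_neq0 // addrN.
- by apply/injectiveP.
- rewrite size_codom card_ord -ltnS -(size_nodal lam).
  rewrite [X in (size (polyseq (X - _))%R < _)%N](divp_eq p (nodal lam)) /secular opprB.
  rewrite addrC -addrA [- _ + _]addrA addNr add0r.
  rewrite (leq_ltn_trans (size_polyD _ _)) // gtn_max size_partial.
  by rewrite ltn_modp (monic_neq0 (nodal_monic lam)).
Qed.
End Secular.

(** * Interlacing sequences *)

Lemma prod_sign_ge0 (R : realDomainType) m t (x : 'I_m -> R) :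
  (forall i : 'I_m, (i < t)%N -> 0 <= x i) ->
  (forall i : 'I_m, (t <= i)%N -> x i <= 0) ->
  0 <= (-1) ^+ (m - t) * \prod_i x i.
Proof.
elim: m x => [|m IHm] x x_ge0 x_le0; first by rewrite sub0n big_ord0 mulr1.
rewrite big_ord_recr /=.
have IH : 0 <= (-1) ^+ (m - t) * \prod_i x (widen_ord (leqnSn m) i).
  by apply: IHm => i ti; [rewrite x_ge0 | rewrite x_le0].
have [mt|tm] := ltnP m t.
  have [m0 m1] : ((m - t = 0) /\ (m.+1 - t = 0))%N by lia.
  by move: IH; rewrite m0 m1 !expr0 !mul1r => IH; rewrite mulr_ge0 // x_ge0.
rewrite subSn // exprS mulN1r -mulrN1 -mulrA mulN1r -mulrN mulrA.
by rewrite mulr_ge0 // oppr_ge0 x_le0.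
Qed.

Section Interlacing.
Context {R : realFieldType} {n m : nat} (e : bool).
Implicit Types (lam : n.-tuple R) (mu : m.-tuple R).

(** The boxes of both maps at once: [e] is [false] for the spectrum of
S + v v^*, and [true] for that of the bordered matrix, whose first entry has no
lower bound. *)
Definition interlaces lam mu :=
  forall (i : 'I_m) (j : 'I_n),
    (i = (j + e)%N :> nat -> tnth lam j <= tnth mu i) /\
    (i.+1 = (j + e)%N :> nat -> tnth mu i <= tnth lam j).

Hypothesis mE : m = (n + e)%N.
Variables (lam : n.-tuple R) (mu : m.-tuple R).
Hypotheses (lam_lt : sorted <%O lam) (lam_mu : interlaces lam mu).

Lemma node_lt (i j : 'I_n) : (i < j)%N -> tnth lam i < tnth lam j.
Proof.
move=> ij; rewrite !(tnth_nth 0).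
by rewrite (sorted_ltn_nth lt_trans) // inE size_tuple.
Qed.

Lemma node_le (i j : 'I_n) : (i <= j)%N -> tnth lam i <= tnth lam j.
Proof. by rewrite leq_eqVlt => /predU1P[/val_inj->//|/node_lt/ltW]. Qed.

Lemma node_inj : injective (tnth lam).
Proof.
move=> i j lij; apply/val_inj; case: (ltngtP i j) => // /node_lt;
by rewrite lij ltxx.
Qed.

Lemma interlaces_le (i : 'I_m) (j : 'I_n) :
  (j + e <= i)%N -> tnth lam j <= tnth mu i.
Proof.
move=> ji; have ltj : (i - e < n)%N by have := ltn_ord i; lia.
have [+ _] := lam_mu i (Ordinal ltj) => /=; rewrite subnK; last by lia.
by move=> /(_ erefl); apply: le_trans; apply: node_le => /=; lia.
Qed.

Lemma interlaces_ge (i : 'I_m) (j : 'I_n) :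
  (i < j + e)%N -> tnth mu i <= tnth lam j.
Proof.
move=> ij; have ltj : (i.+1 - e < n)%N by case: (e) ij; have := ltn_ord j; lia.
have [_ +] := lam_mu i (Ordinal ltj) => /=; rewrite subnK; last by case: (e).
by move=> /(_ erefl) /le_trans; apply; apply: node_le => /=; lia.
Qed.

(** Any two entries of mu are separated by a node: hence mu is sorted, and an
entry which is not a node occurs only once. *)
Lemma interlaces_between (i i' : 'I_m) : (i < i')%N ->
  exists2 j : 'I_n, tnth mu i <= tnth lam j & tnth lam j <= tnth mu i'.
Proof.
move=> ii; have ltj : (i' - e < n)%N.
  by case: (e) mE => ?; have := ltn_ord i'; lia.
exists (Ordinal ltj).
  by apply: interlaces_ge => /=; case: (e); lia.
by apply: interlaces_le => /=; case: (e); lia.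
Qed.

Lemma interlaces_sorted : sorted <=%O mu.
Proof.
apply/(pairwise_sorted)/(pairwiseP 0) => i j; rewrite !inE !size_tuple => im jm ij.
rewrite -(tnth_nth _ _ (Ordinal im)) -(tnth_nth _ _ (Ordinal jm)).
have [k ik kj] := @interlaces_between (Ordinal im) (Ordinal jm) ij.
exact: le_trans ik kj.
Qed.

(** At the j-th node, the product of the differences lam_j - mu_i has n - j
nonpositive factors and the product of the lam_j - lam_i has n - j - 1 negative
ones: the signs are opposite. *)
Lemma interlaces_weight_ge0 (j : 'I_n) :
  0 <= weight (tnth lam) (nodal (tnth mu)) j.
Proof.
rewrite /weight /nodal horner_prod; under eq_bigr => i _ do rewrite hornerXsubC.
set p := (X in - X); set D := (X in _ / X).
have p_ge0 : 0 <= (-1) ^+ (n - j) * p.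
  have -> : (n - j = m - (j + e))%N by rewrite mE; lia.
  apply: prod_sign_ge0 => i ij.
    by rewrite subr_ge0 interlaces_ge.
  by rewrite subr_le0 interlaces_le.
have D_gt0 : 0 < (-1) ^+ (n - j.+1) * D.
  rewrite lt_neqAle eq_sym mulf_neq0 ?signr_eq0 ?(prod_neq_sub_neq0 _ node_inj) //=.
  rewrite /D big_mkcond; apply: prod_sign_ge0 => i ij; case: eqP => //= ne.
    by rewrite subr_ge0 node_le.
  - by move: ij; rewrite ne ltnn.
  - by rewrite subr_le0 node_le // ltnW.
move: p_ge0; rewrite -(subnSK (ltn_ord j)) exprS mulN1r mulNr -mulrN.
move=> /divr_ge0 /(_ (ltW D_gt0)).
by rewrite -mulf_div divff ?mul1r // signr_eq0.
Qed.

(** Since the nodes are distinct, mu_i can only equal the two nodes which bound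
it. *)
Lemma tnth_eq_face (i : 'I_m) (j : 'I_n) : tnth mu i = tnth lam j ->
  (i == j + e :> nat)%N || (i.+1 == j + e :> nat)%N.
Proof.
move=> mu_lam; apply/norP => -[/eqP ij /eqP ij'].
have [lt_ji|le_ij] := ltnP (j + e) i.
  have ltj : (j.+1 < n)%N by have := ltn_ord i; lia.
  have := @interlaces_le i (Ordinal ltj); rewrite mu_lam /= => /(_ lt_ji).
  by apply/negP; rewrite -ltNge node_lt /=.
have j_gt0 : (0 < j)%N by case: (e) ij ij' le_ij => /=; lia.
have ltj : (j.-1 < n)%N by have := ltn_ord j; lia.
have := @interlaces_ge i (Ordinal ltj); rewrite mu_lam /= => H.
have : tnth lam j <= tnth lam (Ordinal ltj) by apply: H; lia.
by apply/negP; rewrite -ltNge node_lt //=; lia.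
Qed.

(** The number k of faces is the number of incidences mu_i = lam_j.  Let z be
the number of nodes in mu and y the number of entries of mu which are not
nodes.  Then mu has k + y entries and z + y distinct ones, so there are k - z
repetitions and n + (k - z) - k = n - z nodes outside mu. *)
Lemma card_faces_repeats (faces : {set 'I_m * 'I_n}) :
  (forall i j, ((i, j) \in faces) =
     ((i == j + e :> nat)%N || (i.+1 == j + e :> nat)%N) && (tnth mu i == tnth lam j)) ->
  (n + (size mu - size (undup mu)) - #|faces|)%N = #|[pred j | tnth lam j \notin mu]|.
Proof.
move=> facesE; pose I_off := [pred i | tnth mu i \notin lam].
pose J_in := [pred j | tnth lam j \in mu].
have -> : #|faces| = (\sum_(i < m) \sum_(j < n) (tnth mu i == tnth lam j))%N.
  rewrite pair_bigA -sum1_card big_mkcond /=.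
  apply: eq_bigr => -[i j] _ /=.
  rewrite facesE; case: (tnth mu i =P _) => [mu_j|_]; last by rewrite andbF.
  by rewrite (tnth_eq_face mu_j).
have mE' : m = (#|I_off| + \sum_(i < m) \sum_(j < n) (tnth mu i == tnth lam j))%N.
  rewrite -[LHS]card_ord -sum1_card -sum1_card [X in (X + _)%N]big_mkcond -big_split.
  apply: eq_bigr => i _; rewrite inE /=.
  case: (tnthP lam (tnth mu i)) => [[j mu_j]|mu_off] /=.
    rewrite (bigD1 j) //= mu_j eqxx big1 // => j'.
    by rewrite (inj_eq node_inj) eq_sym => /negPf->.
  by rewrite big1 // => j _; case: eqP => // mu_j; case: mu_off; exists j.
(* The distinct entries of mu are the nodes in mu and the entries that are not
   nodes; the latter are pairwise distinct by separation. *)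
have undupE : size (undup mu) = (#|J_in| + #|I_off|)%N.
  rewrite !cardE -(size_map (tnth lam)) -(size_map (tnth mu) (enum I_off)) -size_cat.
  apply: perm_size; apply: uniq_perm; first exact: undup_uniq.
    rewrite cat_uniq !map_inj_in_uniq ?enum_uniq ?andbT /=; last 2 first.
    - have off_lt i i' : i \in enum I_off -> tnth mu i = tnth mu i' -> ~ (i < i')%N.
        rewrite mem_enum inE => /negP i_off mu_ii' /interlaces_between[j ij ji'].
        by apply: i_off; apply/tnthP; exists j; apply/le_anti; rewrite ij mu_ii'.
      move=> i i' Ii Ii' mu_ii'; apply/val_inj; case: (ltngtP i i') => // ii'.
        by case: (off_lt i i').
      by case: (off_lt i' i).
    - by move=> ? ? _ _; apply: node_inj.
    apply/hasPn => _ /mapP[i + ->]; rewrite mem_enum inE => i_off.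
    by apply: contra i_off => /mapP[j _ ->]; apply: mem_tnth.
  move=> x; rewrite mem_undup mem_cat; apply/idP/orP => [/tnthP[i ->]|[]].
  - have [mu_lam|mu_off] := boolP (tnth mu i \in lam).
      left; case/tnthP: (mu_lam) => j mu_j; rewrite mu_j map_f // mem_enum inE.
      by rewrite -mu_j mem_tnth.
    by right; rewrite map_f // mem_enum.
  - by case/mapP => j + ->; rewrite mem_enum.
  - by case/mapP => i _ ->; apply: mem_tnth.
have nE : n = (#|J_in| + #|[pred j | tnth lam j \notin mu]|)%N.
  by rewrite -[LHS]card_ord -(cardC J_in); congr (_ + _)%N; apply: eq_card.
have := size_undup mu; rewrite undupE size_tuple.
by move: mE' nE; set s := (\sum_(i < m) _)%N; lia.
Qed.
End Interlacing.

(** * Hermitian matrices and their sorted spectra *)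

Section ComplexReal.
Context {R : realType}.
Implicit Types (x y : R) (z : Cplx R).

HB.instance Definition _ := GRing.RMorphism.copy (@toC R) (real_complex R).

Lemma toCK : cancel (@toC R) (@reC R). Proof. by []. Qed.

Lemma toC_inj : injective (@toC R). Proof. exact: can_inj toCK. Qed.

Lemma ler_toC x y : (toC x <= toC y) = (x <= y).
Proof. exact: lecR. Qed.

Lemma ltr_toC x y : (toC x < toC y) = (x < y).
Proof. exact: ltcR. Qed.

Lemma toC_ge0 x : (0 <= toC x) = (0 <= x).
Proof. by rewrite -ler_toC rmorph0. Qed.

Lemma toC_real x : toC x \is Num.real.
Proof. by rewrite realE -(rmorph0 (@toC R)) !ler_toC -realE num_real. Qed.

Lemma reCK z : z \is Num.real -> toC (reC z) = z.
Proof. exact: RRe_real. Qed.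

Lemma toC_norm x : `|toC x| = toC `|x|.
Proof.
have [x_ge0|/ltW x_le0] := leP 0 x.
  by rewrite !ger0_norm ?toC_ge0.
by rewrite !ler0_norm ?rmorphN // -(rmorph0 (@toC R)) ler_toC.
Qed.
End ComplexReal.

Section Eigenbasis.
Local Open Scope sesquilinear_scope.
Context {R : realType}.

Lemma conj_toC (x : R) : (toC x)^* = toC x.
Proof. exact/CrealP/toC_real. Qed.

Lemma eigenbasisE n (A U : 'M[Cplx R]_n) (mu : n.-tuple R) :
  is_eigenbasis A mu U ->
  A = U *m diag_mx (\row_j toC (tnth mu j)) *m U^t*.
Proof.
case=> U_unit AU; rewrite -[LHS]mulmx1 -(unitarymxP U_unit) mulmxA.
congr (_ *m _); apply/matrixP => i j; rewrite mul_mx_diag !mxE mulrC.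
have /matrixP/(_ i 0) := AU j; rewrite !mxE => <-.
by apply: eq_bigr => k _; rewrite !mxE.
Qed.

Lemma eigenbasis_unit n (A U : 'M[Cplx R]_n) (mu : n.-tuple R) :
  is_eigenbasis A mu U -> U \is unitarymx.
Proof. by case. Qed.

Lemma sigma_o_sorted n (A : 'M[Cplx R]_n) : sorted <=%O (sigma_o A).
Proof. exact: sort_le_sorted. Qed.

(** The spectral theorem gives a unitary basis for the unsorted eigenvalues;
permuting its columns by the sorting permutation is harmless. *)
Lemma sigma_o_eigenbasis n (A : 'M[Cplx R]_n) : A \is hermsymmx ->
  exists U, is_eigenbasis A (sigma_o A) U.
Proof.
move=> A_herm; set P := spectralmx A.
have P_unit : P \is unitarymx := spectral_unitarymx A.
have /mxOverP sp_real := hermitian_spectral_diag_real A_herm.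
have AE := orthomx_spectralP (hermitian_normalmx A_herm).
have AP : A *m P^t* = P^t* *m diag_mx (spectral_diag A).
  by rewrite {1}AE invmx_unitary // mulmxtVK.
have /tuple_permP[p pE] :
    perm_eq (sigma_o A) [tuple reC (spectral_diag A 0 i) | i < n].
  by rewrite perm_sort.
exists (col_perm p (P^t*)); split.
  apply/unitarymxP; rewrite -[RHS](unitarymxP (_ : P^t* \is unitarymx)); last first.
    by rewrite trmxC_unitary.
  apply/matrixP => i j; rewrite mxE [RHS]mxE [RHS](reindex_inj (@perm_inj _ p)).
  by apply: eq_bigr => k _; rewrite !mxE.
move=> j; have -> : tnth (sigma_o A) j = reC (spectral_diag A 0 (p j)).
  by rewrite (_ : sigma_o A = [tuple tnth [tuple reC (spectral_diag A 0 i) | i < n]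
    (p i) | i < n]) ?tnth_mktuple //; apply/val_inj.
rewrite reCK; last exact: sp_real.
apply/matrixP => i k; have /matrixP/(_ i (p j)) := AP.
rewrite mul_mx_diag !mxE mulrC => <-.
by apply: eq_bigr => l _; rewrite !mxE.
Qed.

Lemma char_poly_conj (F : fieldType) n (V W M : 'M[F]_n) : V *m W = 1%:M ->
  char_poly (V *m M *m W) = char_poly M.
Proof.
move=> VW; pose pV := map_mx polyC V; pose pW := map_mx polyC W.
have pVW : pV *m pW = 1%:M by rewrite -map_mxM VW map_mx1.
have : char_poly_mx (V *m M *m W) = pV *m char_poly_mx M *m pW.
  rewrite /char_poly_mx !map_mxM mulmxBr mulmxBl -/pV -/pW.
  by rewrite scalar_mxC -[X in _ = X - _]mulmxA pVW mulmx1.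
by rewrite /char_poly => ->; rewrite !det_mulmx mulrAC -det_mulmx pVW det1 mul1r.
Qed.

Lemma char_poly_eigenbasis n (A U : 'M[Cplx R]_n) (mu : n.-tuple R) :
  is_eigenbasis A mu U ->
  char_poly A = map_poly (@toC R) (nodal (tnth mu)).
Proof.
move=> AU; have U_unit := eigenbasis_unit AU.
rewrite (eigenbasisE AU) char_poly_conj; last exact/unitarymxP.
rewrite char_poly_trig ?diag_mx_is_trig // /nodal rmorph_prod /=.
by apply: eq_bigr => i _; rewrite map_polyXsubC !mxE eqxx.
Qed.

(** A sorted real tuple is determined by the monic polynomial of which it
lists the roots; so statements about [sigma_o] become identities between
characteristic polynomials. *)
Lemma sigma_oP n (A : 'M[Cplx R]_n) (mu : n.-tuple R) :
  A \is hermsymmx -> sorted <=%O mu ->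
  sigma_o A = mu <->
  char_poly A = map_poly (@toC R) (nodal (tnth mu)).
Proof.
move=> A_herm mu_sorted; have [U /char_poly_eigenbasis AU] := sigma_o_eigenbasis A_herm.
split=> [<- //|]; rewrite AU => /(map_poly_inj (@toC R)).
rewrite /nodal -!(big_tuple _ _ _ predT (fun x => 'X - x%:P)) /=.
move=> /prod_XsubC_eq mu_perm.
apply/val_inj/(sorted_eq le_trans le_anti) => //; exact: sigma_o_sorted.
Qed.

Lemma eigen_form n (A U : 'M[Cplx R]_n) (mu : n.-tuple R) (w : 'rV_n) :
  is_eigenbasis A mu U ->
  (w *m A *m w^t*) 0 0 = \sum_j toC (tnth mu j) * `|(w *m U) 0 j| ^+ 2.
Proof.
move=> AU; rewrite (eigenbasisE AU) !mulmxA.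
rewrite -mulmxA -map_mxM -trmx_mul; set y := w *m U; rewrite mxE.
by apply: eq_bigr => j _; rewrite mul_mx_diag !mxE mulrAC -normCK mulrC.
Qed.

Lemma unitary_norm n (U : 'M[Cplx R]_n) (w : 'rV_n) : U \is unitarymx ->
  (w *m w^t*) 0 0 = \sum_j `|(w *m U) 0 j| ^+ 2.
Proof.
move=> U_unit; rewrite -[X in X *m _](mulmxtVK w U_unit).
rewrite -mulmxA -map_mxM -trmx_mul; set y := w *m U; rewrite mxE.
by apply: eq_bigr => j _; rewrite !mxE -normCK.
Qed.
End Eigenbasis.

(** * The Courant-Fischer argument and Cauchy interlacing *)

Lemma exists_orthogonal (F : fieldType) p (cs : seq 'cV[F]_p) :
  (size cs < p)%N ->
  exists2 w : 'rV_p, w != 0 & {in cs, forall c, w *m c = 0}.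
Proof.
move=> cs_lt; pose M := \matrix_(i < p, j < size cs) nth 0 cs j i 0.
have : kermx M != 0.
  rewrite -mxrank_eq0 mxrank_ker subn_eq0 -ltnNge.
  exact: leq_ltn_trans (rank_leq_col M) _.
case/rowV0Pn => w /sub_kermxP wM w0; exists w => // c /(nthP 0)[k k_lt <-].
apply/matrixP => i j; rewrite !ord1.
have /matrixP/(_ 0 (Ordinal k_lt)) := wM; rewrite !mxE => wM0.
by rewrite -[RHS]wM0; apply: eq_bigr => l _; rewrite !mxE.
Qed.

Lemma card_ord_lt n k : (k <= n)%N -> #|[pred i : 'I_n | (i < k)%N]| = k.
Proof.
move=> kn; rewrite -sum1_card (eq_bigl (fun i : 'I_n => (i < k)%N)) //.
by rewrite -(big_ord_widen _ (fun=> 1%N)) // sum1_card card_ord.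
Qed.

Lemma card_ord_gt n k : (k < n)%N ->
  #|[pred i : 'I_n | (k < i)%N]| = (n - k.+1)%N.
Proof.
move=> kn; have := cardC [pred i : 'I_n | (i < k.+1)%N].
rewrite card_ord_lt // card_ord => nE; rewrite -[X in (X - _)%N]nE addKn.
by apply: eq_card => i; rewrite !inE -leqNgt.
Qed.

Section CourantFischer.
Local Open Scope sesquilinear_scope.
Context {R : realType}.

Lemma form_le_eigen n (A U : 'M[Cplx R]_n) (mu : n.-tuple R) (w : 'rV_n)
    (i : 'I_n) :
  is_eigenbasis A mu U -> sorted <=%O mu ->
  (forall j : 'I_n, (i < j)%N -> (w *m U) 0 j = 0) ->
  (w *m A *m w^t*) 0 0 <= toC (tnth mu i) * (w *m w^t*) 0 0.
Proof.
move=> AU mu_sorted wU; rewrite (eigen_form _ AU).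
rewrite (unitary_norm _ (eigenbasis_unit AU)) mulr_sumr; apply: ler_sum => j _.
have [/wU ->|ji] := ltnP i j; first by rewrite normr0 expr0n !mulr0.
rewrite ler_wpM2r ?exprn_ge0 // ler_toC !(tnth_nth 0).
by rewrite (sorted_leq_nth le_trans le_refl) // inE size_tuple.
Qed.

Lemma form_ge_eigen n (A U : 'M[Cplx R]_n) (mu : n.-tuple R) (w : 'rV_n)
    (i : 'I_n) :
  is_eigenbasis A mu U -> sorted <=%O mu ->
  (forall j : 'I_n, (j < i)%N -> (w *m U) 0 j = 0) ->
  toC (tnth mu i) * (w *m w^t*) 0 0 <= (w *m A *m w^t*) 0 0.
Proof.
move=> AU mu_sorted wU; rewrite (eigen_form _ AU).
rewrite (unitary_norm _ (eigenbasis_unit AU)) mulr_sumr; apply: ler_sum => j _.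
have [/wU ->|ji] := ltnP j i; first by rewrite normr0 expr0n !mulr0.
rewrite ler_wpM2r ?exprn_ge0 // ler_toC !(tnth_nth 0).
by rewrite (sorted_leq_nth le_trans le_refl) // inE size_tuple.
Qed.

Lemma norm_gt0 n (w : 'rV[Cplx R]_n) : w != 0 -> 0 < (w *m w^t*) 0 0.
Proof.
move=> w0; have /eqP -> : (w *m w^t*) 0 0 == \sum_j `|w 0 j| ^+ 2.
  by rewrite mxE; apply/eqP/eq_bigr => j _; rewrite !mxE -normCK.
have [j wj0] : exists j, w 0 j != 0 by apply/rV0Pn.
rewrite (bigD1 j) //= ltr_pwDl ?exprn_gt0 ?normr_gt0 //.
by apply: sumr_ge0 => k _; rewrite exprn_ge0.
Qed.

(** The matrices A and B are compared through maps I and J from a common space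
of dimension p, on the subspace cut out by the conditions [cs].  There, the
conditions that w I avoid the eigenvectors of A after the i-th and that w J
avoid those of B before the j-th still leave some w <> 0, for which
nu_j |w|^2 <= B-form <= A-form <= mu_i |w|^2. *)
Lemma courant_fischer p m n (A U : 'M[Cplx R]_m) (mu : m.-tuple R)
    (B V : 'M[Cplx R]_n) (nu : n.-tuple R)
    (I : 'M[Cplx R]_(p, m)) (J : 'M[Cplx R]_(p, n)) (cs : seq 'cV_p)
    (i : 'I_m) (j : 'I_n) :
  is_eigenbasis A mu U -> sorted <=%O mu ->
  is_eigenbasis B nu V -> sorted <=%O nu ->
  (forall w : 'rV_p, {in cs, forall c, w *m c = 0} ->
     let wI := w *m I in let wJ := w *m J in
     [/\ (wI *m wI^t*) 0 0 = (w *m w^t*) 0 0,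
         (wJ *m wJ^t*) 0 0 = (w *m w^t*) 0 0 &
         (wJ *m B *m wJ^t*) 0 0 <= (wI *m A *m wI^t*) 0 0]) ->
  (m - i.+1 + j + size cs < p)%N ->
  tnth nu j <= tnth mu i.
Proof.
move=> AU mu_sorted BV nu_sorted cs_form card_lt.
(* The conditions that w I have no component on an eigenvector of A after the
   i-th, and w J none on an eigenvector of B before the j-th. *)
pose csA := [seq I *m col k U | k <- enum [pred k : 'I_m | (i < k)%N]].
pose csB := [seq J *m col k V | k <- enum [pred k : 'I_n | (k < j)%N]].
have csAP (k : 'I_m) : (i < k)%N -> I *m col k U \in csA.
  by move=> ik; apply/(map_f (fun k => I *m col k U)); rewrite mem_enum.
have csBP (k : 'I_n) : (k < j)%N -> J *m col k V \in csB.
  by move=> kj; apply/(map_f (fun k => J *m col k V)); rewrite mem_enum.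
have [|w w0 w_cs] := @exists_orthogonal _ _ (csA ++ csB ++ cs).
  rewrite !size_cat !size_map -!cardE (card_ord_lt (ltnW (ltn_ord j))).
  by rewrite (card_ord_gt (ltn_ord i)) addnA.
have w_cs' : {in cs, forall c, w *m c = 0}.
  by move=> c c_cs; apply: w_cs; rewrite !mem_cat c_cs !orbT.
have [wI wJ le_BA] := cs_form _ w_cs'.
have vanish q (X : 'M[Cplx R]_(p, q)) (W : 'M[Cplx R]_q) k :
    w *m (X *m col k W) = 0 -> (w *m X *m W) 0 k = 0.
  by rewrite mulmxA colE mulmxA -colE => /matrixP/(_ 0 0); rewrite !mxE.
have leA := form_le_eigen AU mu_sorted (w := w *m I) (i := i).
have leB := form_ge_eigen BV nu_sorted (w := w *m J) (i := j).
have : toC (tnth nu j) * (w *m w^t*) 0 0 <= toC (tnth mu i) * (w *m w^t*) 0 0.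
  rewrite -{1}wJ -wI (le_trans (leB _)) ?(le_trans le_BA) ?leA // => k k_lt.
    by apply/vanish/w_cs; rewrite !mem_cat csBP ?orbT.
  by apply/vanish/w_cs; rewrite !mem_cat csAP.
by rewrite ler_pM2r ?norm_gt0 // ler_toC.
Qed.

Lemma tensor_form n (v : 'cV[Cplx R]_n) (w : 'rV_n) :
  (w *m tensor v *m w^t*) 0 0 = `|(w *m v) 0 0| ^+ 2.
Proof.
rewrite /tensor !mulmxA -mulmxA -map_mxM -trmx_mul.
by rewrite [w *m v]mx11_scalar tr_scalar_mx map_scalar_mx -scalar_mxM !mxE -normCK.
Qed.

(** Adding v v^* increases the quadratic form, which gives the lower bounds;
the single condition w v = 0 makes both forms agree, which gives the upper
bounds with a shift of one index. *)
Lemma interlaces_hatF n (S Q : 'M[Cplx R]_n) (lam : n.-tuple R) v :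
  S + tensor v \is hermsymmx -> sorted <=%O lam -> is_eigenbasis S lam Q ->
  interlaces false lam (hatF S v).
Proof.
move=> T_herm lam_sorted SQ i j; rewrite addn0.
have [U TU] := sigma_o_eigenbasis T_herm.
split=> ij.
  apply: (@courant_fischer n _ _ _ _ _ _ _ _ 1%:M 1%:M [::] i j TU _ SQ) => //.
  - exact: sigma_o_sorted.
  - move=> w _ /=; rewrite !mulmx1; split => //.
    by rewrite mulmxDr mulmxDl [leRHS]mxE lerDl tensor_form exprn_ge0.
  - by rewrite -ij /=; have := ltn_ord i; lia.
apply: (@courant_fischer n _ _ _ _ _ _ _ _ 1%:M 1%:M [:: v] j i SQ _ TU) => //.
- exact: sigma_o_sorted.
- move=> w w_v /=; rewrite !mulmx1; split => //.
  rewrite mulmxDr mulmxDl [leLHS]mxE tensor_form w_v ?mem_head //.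
  by rewrite [(0 : matrix _ _ _) _ _]mxE normr0 expr0n addr0.
- by rewrite -ij /=; have := ltn_ord j; lia.
Qed.

(** On the hyperplane where the last coordinate vanishes the form of the
bordered matrix is that of S, so one condition is spent in both directions. *)
Lemma interlaces_hatG n (S Q : 'M[Cplx R]_n) (lam : n.-tuple R) vc :
  bordered S vc.1 vc.2 \is hermsymmx -> sorted <=%O lam ->
  is_eigenbasis S lam Q ->
  interlaces true lam (hatG S vc).
Proof.
move=> T_herm lam_sorted SQ i j; rewrite (addn1 j).
have [U TU] := sigma_o_eigenbasis T_herm.
pose J : 'M[Cplx R]_(n + 1, n) := col_mx 1%:M 0.
pose cs : seq 'cV[Cplx R]_(n + 1) := [:: col_mx 0 1%:M].
have cs_form (w : 'rV_(n + 1)) : {in cs, forall c, w *m c = 0} ->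
    (w *m J *m (w *m J)^t* = w *m w^t*) /\
    w *m J *m S *m (w *m J)^t* = w *m bordered S vc.1 vc.2 *m w^t*.
  move=> /(_ _ (mem_head _ _)); rewrite -[w]hsubmxK; move: (lsubmx w) (rsubmx w).
  move=> x y; rewrite mul_row_col mulmx0 mulmx1 add0r => ->.
  rewrite mul_row_col mulmx0 mulmx1 addr0 /bordered mul_row_block !mul0mx !addr0.
  by rewrite tr_row_mx map_col_mx !mul_row_col trmx0 map_mx0 !mulmx0 !addr0.
split=> ij.
  apply: (@courant_fischer _ _ _ _ _ _ _ _ _ 1%:M J cs i j TU _ SQ) => //.
  - exact: sigma_o_sorted.
  - by move=> w /cs_form[wJ wS] /=; rewrite mulmx1 wJ wS.
  - by rewrite ij /=; have := ltn_ord i; have := ltn_ord j; lia.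
apply: (@courant_fischer _ _ _ _ _ _ _ _ _ J 1%:M cs j i SQ _ TU) => //.
- exact: sigma_o_sorted.
- by move=> w /cs_form[wJ wS] /=; rewrite mulmx1 wJ wS.
- by case: ij => -> /=; have := ltn_ord j; lia.
Qed.
End CourantFischer.

(** * Characteristic polynomials in the coordinates of the eigenbasis *)

Lemma map_secular (F F' : fieldType) (f : {rmorphism F -> F'}) n
    (lam a : 'I_n -> F) L :
  map_poly f (secular lam a L) = secular (f \o lam) (f \o a) (map_poly f L).
Proof.
rewrite /secular /nodal rmorphB rmorphM rmorph_prod rmorph_sum /=.
congr (_ * _ - _).
  by apply: eq_bigr => i _; rewrite map_polyXsubC.
apply: eq_bigr => j _; rewrite map_polyZ rmorph_prod /=; congr (_ *: _).
by apply: eq_bigr => i _; rewrite map_polyXsubC.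
Qed.

Section CharPoly.
Local Open Scope sesquilinear_scope.
Context {R : realType} {n : nat}.
Implicit Types (d : 'rV[Cplx R]_n) (x : 'cV[Cplx R]_n).

Lemma prod_XsubC_neq0 d : \prod_i (\row_j ('X - (d 0 j)%:P) : 'rV_n) 0 i != 0.
Proof.
under eq_bigr do rewrite mxE.
exact: monic_neq0 (monic_prod_XsubC _ _ _).
Qed.

Lemma char_poly_mx_diag d :
  char_poly_mx (diag_mx d) = diag_mx (\row_j ('X - (d 0 j)%:P)).
Proof.
apply/matrixP => i j; rewrite !mxE; case: (i == j) => //=.
by rewrite polyC0 subr0.
Qed.

(** The left-hand side is the value of [det_arrow] and [det_diag_rank1] for the
diagonal matrix X - diag(d) bordered by x and its adjoint. *)
Lemma arrow_secularE d x L :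
  L * \prod_i (\row_j ('X - (d 0 j)%:P) : 'rV_n) 0 i -
    \sum_j (map_mx polyC (x^t*)) 0 j * (map_mx polyC x) j 0 *
      \prod_(i | i != j) (\row_j ('X - (d 0 j)%:P) : 'rV_n) 0 i =
  secular (d 0) (fun j => `|x j 0| ^+ 2) L.
Proof.
rewrite /secular /nodal; congr (_ * _ - _).
  by apply: eq_bigr => i _; rewrite !mxE.
apply: eq_bigr => j _; rewrite !mxE -polyCM mulrC normCK [_^* * _]mulrC.
rewrite -mul_polyC mulrC; congr (_ * _).
by apply: eq_bigr => i _; rewrite !mxE.
Qed.

Lemma char_poly_diag_tensor d x :
  char_poly (diag_mx d + tensor x) = secular (d 0) (fun j => `|x j 0| ^+ 2) 1.
Proof.
rewrite -arrow_secularE mul1r -(det_diag_rank1 _ _ (prod_XsubC_neq0 d)) /char_poly.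
rewrite -char_poly_mx_diag /char_poly_mx raddfD /= opprD addrA.
by rewrite /tensor map_mxM.
Qed.

Lemma char_poly_diag_bordered d x (c : R) :
  char_poly (bordered (diag_mx d) x c) =
  secular (d 0) (fun j => `|x j 0| ^+ 2) ('X - (toC c)%:P).
Proof.
rewrite -arrow_secularE /char_poly.
have -> : char_poly_mx (bordered (diag_mx d) x c) =
    block_mx (diag_mx (\row_j ('X - (d 0 j)%:P))) (- map_mx polyC x)
      (- map_mx polyC (x^t*)) ('X - (toC c)%:P)%:M.
  rewrite -char_poly_mx_diag /char_poly_mx /bordered map_block_mx.
  rewrite [X in X - _]scalar_mx_block opp_block_mx add_block_mx !add0r.
  by rewrite map_scalar_mx raddfB.
rewrite det_arrow ?prod_XsubC_neq0 //; congr (_ - _); apply: eq_bigr => j _.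
by congr (_ * _); rewrite mxE [(- map_mx _ x) _ _]mxE mulrNN.
Qed.

Variables (S Q : 'M[Cplx R]_n) (lam : n.-tuple R).
Hypothesis SQ : is_eigenbasis S lam Q.
Let Q_unit : Q \is unitarymx := eigenbasis_unit SQ.
Implicit Type v : 'cV[Cplx R]_n.

Definition coord v j : Cplx R := (invmx Q *m v) j 0.

Definition sqcoord v j : R := reC `|coord v j| ^+ 2.

Lemma toC_sqcoord v j : toC (sqcoord v j) = `|coord v j| ^+ 2.
Proof. by rewrite -[X in _ = X ^+ 2]reCK ?normr_real //; apply: (rmorphXn (@toC R)). Qed.

Let secular_toC v L :
  secular ((\row_j toC (tnth lam j)) 0) (fun j => `|(invmx Q *m v) j 0| ^+ 2)
    (map_poly (@toC R) L) =
  map_poly (@toC R) (secular (tnth lam) (sqcoord v) L).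
Proof.
rewrite map_secular; congr secular; apply/funext => j /=.
  by rewrite mxE.
by rewrite toC_sqcoord.
Qed.

Lemma char_poly_tensor v :
  char_poly (S + tensor v) =
  map_poly (@toC R) (secular (tnth lam) (sqcoord v) 1).
Proof.
rewrite -secular_toC rmorph1 -char_poly_diag_tensor.
rewrite -[RHS](char_poly_conj _ (unitarymxP Q_unit)); congr char_poly.
rewrite mulmxDr mulmxDl -(eigenbasisE SQ); congr (_ + _).
rewrite /tensor invmx_unitary // !mulmxA (unitarymxP Q_unit) mul1mx.
by rewrite -mulmxA -map_mxM -trmx_mul mulmxA (unitarymxP Q_unit) mul1mx.
Qed.

Lemma char_poly_bordered v c :
  char_poly (bordered S v c) =
  map_poly (@toC R) (secular (tnth lam) (sqcoord v) ('X - c%:P)).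
Proof.
rewrite -secular_toC map_polyXsubC -char_poly_diag_bordered.
pose V : 'M[Cplx R]_(n + 1) := block_mx Q 0 0 1%:M.
pose W : 'M[Cplx R]_(n + 1) := block_mx (Q^t*) 0 0 1%:M.
have VW : V *m W = 1%:M.
  rewrite mulmx_block !mulmx0 !mul0mx !addr0 add0r (unitarymxP Q_unit) mulmx1.
  by rewrite -scalar_mx_block.
rewrite -[RHS](char_poly_conj _ VW); congr char_poly.
rewrite /bordered !mulmx_block !mulmx0 !mul0mx !addr0 !add0r !mulmx1 !mul1mx.
rewrite -(eigenbasisE SQ) invmx_unitary // mulmxA (unitarymxP Q_unit) mul1mx.
by rewrite -map_mxM -trmx_mul mulmxA (unitarymxP Q_unit) mul1mx.
Qed.
End CharPoly.

(** * Spectra with prescribed weights *)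

Section Monic.
Context {F : fieldType} {n : nat}.
Implicit Types (lam : 'I_n -> F) (p : {poly F}).

Lemma divp_nodal_monic lam p : p \is monic -> (n < size p)%N ->
  p %/ nodal lam \is monic /\ size (p %/ nodal lam) = (size p - n)%N.
Proof.
move=> p_monic n_lt; have nodal0 := monic_neq0 (nodal_monic lam).
have sz : size (p %/ nodal lam) = (size p - n)%N.
  by rewrite size_divp // size_nodal.
split=> //; apply/monicP; rewrite -(monicP p_monic) [in RHS](divp_eq p (nodal lam)).
rewrite lead_coefDl ?lead_coef_Mmonic ?nodal_monic //.
rewrite size_Mmonic ?nodal_monic -?size_poly_gt0 ?sz ?subn_gt0 //.
have : (size (p %% nodal lam)%R < n.+1)%N by rewrite -(size_nodal lam) ltn_modp.
by move=> /leq_trans -> //; rewrite size_nodal addnS subnK ?(ltnW n_lt).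
Qed.

Lemma monic_size1 p : p \is monic -> size p = 1%N -> p = 1.
Proof.
move=> /monicP p1 sz; rewrite (size1_polyC (eq_leq sz)).
by move: p1; rewrite lead_coefE sz /= => ->.
Qed.

Lemma monic_size2 p : p \is monic -> size p = 2%N -> p = 'X - (- p`_0)%:P.
Proof.
move=> /monicP p1 sz; apply/polyP => -[|[|i]]; rewrite coefB coefX coefC /=.
- by rewrite add0r opprK.
- by move: p1; rewrite lead_coefE sz /= => ->; rewrite subr0.
- by rewrite nth_default ?sz // subr0.
Qed.
End Monic.

Section Fibres.
Local Open Scope sesquilinear_scope.
Context {R : realType} {n : nat}.
Variables (S Q : 'M[Cplx R]_n) (lam : n.-tuple R).
Hypotheses (S_herm : S \is hermsymmx) (SQ : is_eigenbasis S lam Q).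
Hypothesis lam_lt : sorted <%O lam.
Let Q_unit : Q \is unitarymx := eigenbasis_unit SQ.
Let lam_injective := node_inj lam_lt.
Implicit Types (v w : 'cV[Cplx R]_n) (c : R).

Let lam_sorted : sorted <=%O lam.
Proof. by apply: sub_sorted lam_lt => x y /ltW. Qed.

Lemma hermsymmxP {m} {A : 'M[Cplx R]_m} : reflect (A = A^t*) (A \is hermsymmx).
Proof.
by apply: (iffP (is_hermitianmxP _ _ _)); rewrite expr0 scale1r.
Qed.

Lemma tensor_herm v : S + tensor v \is hermsymmx.
Proof.
apply/hermsymmxP; rewrite /tensor raddfD map_mxD -(hermsymmxP S_herm).
by rewrite /= trmx_mul map_mxM trmxCK.
Qed.

Lemma bordered_herm v c : bordered S v c \is hermsymmx.
Proof.
apply/hermsymmxP; rewrite /bordered tr_block_mx map_block_mx trmxCK.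
rewrite -(hermsymmxP S_herm) tr_scalar_mx map_scalar_mx /=.
by congr (block_mx _ _ _ _%:M); rewrite conj_toC.
Qed.

Lemma hatF_interlaces v : interlaces false lam (hatF S v).
Proof. exact: interlaces_hatF (tensor_herm v) lam_sorted SQ. Qed.

Lemma hatG_interlaces vc : interlaces true lam (hatG S vc).
Proof. exact: interlaces_hatG (bordered_herm _ _) lam_sorted SQ. Qed.

(** The only possible corner entry c: a bordered matrix has X - c as quotient of
its characteristic polynomial by that of S. *)
Definition corner (mu : (n + 1).-tuple R) : R :=
  - (nodal (tnth mu) %/ nodal (tnth lam))`_0.

(** The quotient of the spectral polynomial by the nodal polynomial is monic of
degree 0, so the weights alone decide whether the characteristic polynomials
coincide. *)
Lemma hatF_fibre v mu : interlaces false lam mu ->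
  hatF S v = mu <-> sqcoord Q v =1 weight (tnth lam) (nodal (tnth mu)).
Proof.
move=> lam_mu; have mu_sorted : sorted <=%O mu.
  by apply: interlaces_sorted lam_lt lam_mu; rewrite addn0.
apply: (iff_trans (sigma_oP (tensor_herm v) mu_sorted)).
rewrite (char_poly_tensor SQ); split.
  move=> /(map_poly_inj (@toC R)) <- j.
  by rewrite weight_secular.
move=> /funext ->; congr map_poly; rewrite -[RHS](secular_divp_weight _ lam_injective).
have [] := divp_nodal_monic (tnth lam) (nodal_monic (tnth mu)).
  by rewrite size_nodal.
by rewrite size_nodal subSnn => /monic_size1 /[apply] ->.
Qed.

Lemma hatG_fibre v c mu : interlaces true lam mu ->
  hatG S (v, c) = mu <->
  sqcoord Q v =1 weight (tnth lam) (nodal (tnth mu)) /\ c = corner mu.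
Proof.
move=> lam_mu; have mu_sorted : sorted <=%O mu.
  by apply: interlaces_sorted lam_lt lam_mu.
apply: (iff_trans (sigma_oP (bordered_herm v c) mu_sorted)).
rewrite (char_poly_bordered SQ); split.
  move=> /(map_poly_inj (@toC R)) muE; split=> [j|].
    by rewrite -muE weight_secular.
  by rewrite /corner -muE divp_secular coefB coefX coefC /= add0r opprK.
case=> /funext -> ->; congr map_poly.
rewrite -[RHS](secular_divp_weight _ lam_injective).
have [] := divp_nodal_monic (tnth lam) (nodal_monic (tnth mu)).
  by rewrite size_nodal; lia.
rewrite size_nodal (_ : _ - _ = 2)%N; last by lia.
by move=> /monic_size2 /[apply] ->.
Qed.

Lemma absQ_eqP v w : absQ Q v = absQ Q w <-> sqcoord Q v =1 sqcoord Q w.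
Proof.
have QV := unitarymx_unit Q_unit; split=> [|vw]; last first.
  congr (Q *m _); apply/matrixP => j k; rewrite !ord1 !mxE.
  apply/eqP; rewrite -(eqrXn2 (n := 2)) ?normr_ge0 //.
  by have := congr1 (@toC R) (vw j); rewrite !toC_sqcoord /coord !mxE => ->.
move=> /(congr1 (mulmx (invmx Q))); rewrite /absQ !mulKmx // => /matrixP vw j.
by have := vw j 0; rewrite mxE [RHS]mxE /sqcoord /coord => ->.
Qed.

Lemma hatF_eqP v w : hatF S v = hatF S w <-> absQ Q v = absQ Q w.
Proof.
rewrite absQ_eqP (hatF_fibre _ (hatF_interlaces w)).
have /(hatF_fibre _ (hatF_interlaces w)) wE : hatF S w = hatF S w by [].
by split=> vw j; rewrite vw wE.
Qed.

Lemma hatG_eqP v w c : hatG S (v, c) = hatG S (w, c) <-> absQ Q v = absQ Q w.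
Proof.
rewrite absQ_eqP (hatG_fibre _ _ (hatG_interlaces (w, c))).
have /(hatG_fibre _ _ (hatG_interlaces (w, c)))[wE cE] :
  hatG S (w, c) = hatG S (w, c) by [].
by split=> [[vw _] j|vw]; [rewrite vw wE|split=> // j; rewrite vw wE].
Qed.

(** The coordinates in a unitary basis have the same Euclidean norm: this is
why all preimages of a point lie on one sphere. *)
Lemma enormE v : enorm v = Num.sqrt (\sum_j sqcoord Q v j).
Proof.
congr Num.sqrt; apply: toC_inj; rewrite !rmorph_sum.
have normE := unitary_norm (v^t*) Q_unit.
transitivity ((v^t* *m (v^t*)^t*) 0 0).
  rewrite trmxCK mxE; apply: eq_bigr => i _.
  rewrite !mxE mulrC -normCK -[X in _ = X ^+ 2]reCK ?normr_real //.
  exact: (rmorphXn (@toC R)).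
rewrite normE; apply: eq_bigr => j _ /=.
rewrite -[RHS]/(toC (sqcoord Q v j)) toC_sqcoord /coord invmx_unitary //; congr (_ ^+ 2).
rewrite -norm_conjC; congr `|_|; rewrite -[v in RHS]trmxCK.
by rewrite -map_mxM -trmx_mul; set y := v^t* *m Q; rewrite !mxE conjCK.
Qed.

Definition fibre (K : scalars) (r : 'I_n -> R) : set 'cV[Cplx R]_n :=
  Kvec R K n `&` [set v | forall j, `|coord Q v j| = toC (r j)].

Lemma sqcoord_eqP v (a : 'I_n -> R) : (forall j, 0 <= a j) ->
  (sqcoord Q v =1 a) <-> (forall j, `|coord Q v j| = toC (Num.sqrt (a j))).
Proof.
move=> a_ge0; split=> vE j.
  rewrite -vE sqrtr_sqr [X in toC X]ger0_norm ?reCK ?normr_real //.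
  by rewrite -toC_ge0 reCK ?normr_real.
by rewrite /sqcoord vE toCK sqr_sqrtr.
Qed.
End Fibres.

(** * The shape of the fibres *)

Section Continuity.
Context {K : numFieldType}.

(** A neighbourhood of a matrix contains a finite product of neighbourhoods of
its entries. *)
Lemma continuous_mx (T : topologicalType) m n (f : T -> 'M[K]_(m, n)) :
  (forall i j, continuous (fun x => f x i j)) -> continuous f.
Proof.
move=> f_cont x A [P P_nbhs PA].
apply: (filterS (P := fun y => forall i j, P i j (f y i j))).
  by move=> y /PA.
apply: filter_forall => i; apply: filter_forall => j.
by apply: f_cont; apply: P_nbhs.
Qed.

Lemma mulmx_continuous m n p (M : 'M[K]_(m, n)) :
  continuous (fun v : 'M[K]_(n, p) => M *m v).
Proof.
apply: continuous_mx => i j; under eq_fun do rewrite mxE.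
apply: continuous_big => [|k _ x]; first exact: add_continuous.
exact: (continuous_comp (@coord_continuous K n p k j x)
  (@mulrl_continuous K (M i k) _)).
Qed.
End Continuity.

Section FibreShape.
Context {R : realType} {n : nat}.
Variables (Q : 'M[Cplx R]_n).
Hypothesis Q_unit : Q \is unitarymx.
Implicit Types (v w : 'cV[Cplx R]_n) (r : 'I_n -> R).

Lemma coord_mulmx (x : 'cV[Cplx R]_n) j : coord Q (Q *m x) j = x j 0.
Proof. by rewrite /coord mulKmx ?unitarymx_unit. Qed.

Lemma coord_inj v w : coord Q v =1 coord Q w -> v = w.
Proof.
move=> vw; rewrite -[v](mulKVmx (unitarymx_unit Q_unit)).
rewrite -[w in RHS](mulKVmx (unitarymx_unit Q_unit)); congr mulmx.
by apply/matrixP => i j; rewrite ord1; apply: vw.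
Qed.

Variable K : scalars.
Hypothesis QK : forall i j, Q i j \in entries R K.

Lemma Kvec_mulmx (x : 'cV[Cplx R]_n) :
  Kvec R K n x -> Kvec R K n (Q *m x).
Proof.
case: K QK => //= Q_real x_real i; rewrite mxE rpred_sum // => j _.
by rewrite rpredM ?Q_real ?x_real.
Qed.

Lemma coord_entries v j : Kvec R K n v -> coord Q v j \in entries R K.
Proof.
rewrite /coord invmx_unitary //; case: K QK => //= Q_real v_real.
rewrite mxE rpred_sum // => i _; rewrite !mxE rpredM ?v_real //.
by rewrite CrealJ // Q_real.
Qed.

Lemma Kvec_toC (x : 'cV[R]_n) : Kvec R K n (map_mx (@toC R) x).
Proof. by case: K => i //=; rewrite mxE; apply: toC_real. Qed.

Lemma orthant_Kvec : orthant Q `<=` Kvec R K n.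
Proof. by move=> _ [p [_ ->]]; apply/Kvec_mulmx/Kvec_toC. Qed.

Lemma absQ_orthant v : orthant Q (absQ Q v).
Proof.
exists (\col_j reC `|coord Q v j|); split.
  by move=> j; rewrite mxE -toC_ge0 reCK ?normr_real.
congr (Q *m _); apply/matrixP => i j; rewrite !ord1 !mxE reCK ?normr_real //.
by rewrite /coord mxE.
Qed.
End FibreShape.

Lemma real_norm_sign_inj (F : numDomainType) (x y : F) :
  x \is Num.real -> y \is Num.real -> `|x| = `|y| -> (x < 0) = (y < 0) -> x = y.
Proof.
move=> x_real y_real.
by have [_|_] := real_ge0P x_real; have [_|_] := real_ge0P y_real => // /oppr_inj.
Qed.

Section RealFibre.
Context {R : realType} {n : nat}.
Variables (Q : 'M[Cplx R]_n) (r : 'I_n -> R).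
Hypotheses (Q_unit : Q \is unitarymx) (r_ge0 : forall j, 0 <= r j).
Hypothesis Q_real : forall i j, Q i j \in entries R RealScalars.

(** A point of the fibre is determined by the set of its negative coordinates,
and these sets are the subsets of the support of r. *)
Lemma card_fibre_real :
  fibre Q RealScalars r #= `I_(2 ^ #|[pred j | (r j != 0)%R]|).
Proof.
pose J := [set j | (r j != 0)%R]%SET.
have -> : (2 ^ #|[pred j | (r j != 0)%R]| = size (enum (powerset J)))%N.
  by rewrite -cardE card_powerset; congr (_ ^ _)%N; apply: eq_card => j; rewrite !inE.
pose neg (v : 'cV[Cplx R]_n) := [set j | (coord Q v j < 0)%R]%SET.
have neg_J v : fibre Q RealScalars r v -> neg v \in powerset J.
  move=> [_ v_r]; rewrite powersetE; apply/fintype.subsetP => j; rewrite !inE => v_lt0.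
  rewrite -(inj_eq (@toC_inj R)) -v_r rmorph0 normr_eq0; exact: ltr0_neq0.
apply/card_set_bijP; exists (fun v => index (neg v) (enum (powerset J))); split.
- by move=> v /neg_J v_J; rewrite /= index_mem mem_enum.
- move=> v w /set_mem v_fib /set_mem w_fib /index_inj.
  rewrite !mem_enum !neg_J // => /(_ finset.set0 isT isT) /setP neg_vw.
  apply: (coord_inj Q_unit) => j; have := neg_vw j; rewrite !inE.
  have [[v_real v_r] [w_real w_r]] := (v_fib, w_fib).
  move=> /(real_norm_sign_inj _ _ _); apply; last by rewrite v_r w_r.
  - exact: (coord_entries Q_unit Q_real j v_real).
  - exact: (coord_entries Q_unit Q_real j w_real).
- move=> k k_lt; set A := nth finset.set0 (enum (powerset J)) k.
  have A_J : A \subset J by rewrite -powersetE -mem_enum mem_nth.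
  pose x : 'cV[R]_n := \col_j ((-1) ^+ (j \in A) * r j).
  have coord_x j : coord Q (Q *m map_mx (@toC R) x) j = toC ((-1) ^+ (j \in A) * r j).
    by rewrite coord_mulmx // !mxE.
  exists (Q *m map_mx (@toC R) x).
    split; first exact: (Kvec_mulmx Q_real (Kvec_toC RealScalars x)).
    by move=> j; rewrite coord_x toC_norm normrM normr_sign mul1r ger0_norm.
  suff -> : neg (Q *m map_mx (@toC R) x) = A.
    by rewrite index_uniq ?enum_uniq.
  apply/setP => j; rewrite inE coord_x -(rmorph0 (@toC R)) ltr_toC.
  have [/(fintype.subsetP A_J)|_] := boolP (j \in A); rewrite ?inE.
    by move=> r0; rewrite expr1 mulN1r oppr_lt0 lt_neqAle eq_sym r0 r_ge0.
  by rewrite expr0 mul1r; exact: le_gtF.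
Qed.
End RealFibre.

Section ComplexFibre.
Context {R : realType} {n : nat}.
Variables (Q : 'M[Cplx R]_n) (r : 'I_n -> R).
Hypotheses (Q_unit : Q \is unitarymx) (r_ge0 : forall j, 0 <= r j).

Let J := [pred j | r j != 0].

(** The circle coordinates of a point of the fibre.  This map and [of_phases],
which rescales the phases by r and puts 0 outside the support of r, are
restrictions of linear maps, and therefore continuous. *)
Definition phases (v : 'cV[Cplx R]_n) : 'cV[Cplx R]_#|J| :=
  \col_k (coord Q v (enum_val k) / toC (r (enum_val k))).

Definition of_phases (z : 'cV[Cplx R]_#|J|) : 'cV[Cplx R]_n :=
  Q *m ((\matrix_(j, k) (toC (r j) *+ (j == enum_val k))) *m z).

Lemma toC_r_neq0 (k : 'I_#|J|) : toC (r (enum_val k)) != 0.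
Proof.
by rewrite -(rmorph0 (@toC R)) (inj_eq (@toC_inj R)); apply: (enum_valP k).
Qed.

Lemma coord_of_phases_val z (k : 'I_#|J|) :
  coord Q (of_phases z) (enum_val k) = toC (r (enum_val k)) * z k 0.
Proof.
rewrite coord_mulmx // mxE (bigD1 k) //= mxE eqxx mulr1n big1 ?addr0 // => l lk.
by rewrite mxE (inj_eq enum_val_inj) eq_sym (negPf lk) mulr0n mul0r.
Qed.

Lemma coord_of_phases_notin z j : r j = 0 -> coord Q (of_phases z) j = 0.
Proof.
move=> rj; rewrite coord_mulmx // mxE big1 // => k _.
by rewrite mxE rj rmorph0 mul0rn mul0r.
Qed.

Variant support_spec j : Prop :=
  | InJ (k : 'I_#|J|) of j = enum_val k
  | NotInJ of r j = 0.

Lemma supportP j : support_spec j.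
Proof.
have [/eqP/NotInJ//|jJ] := boolP (r j == 0).
have jJ' : j \in J := jJ.
by apply: (InJ (k := enum_rank_in jJ' j)); rewrite enum_rankK_in.
Qed.

Lemma phases_torus : set_fun (fibre Q ComplexScalars r) (torus R #|J|) phases.
Proof.
move=> v [_ v_r] k; rewrite mxE normf_div v_r toC_norm ger0_norm ?divff //.
exact: toC_r_neq0.
Qed.

Lemma of_phases_fibre : set_fun (torus R #|J|) (fibre Q ComplexScalars r) of_phases.
Proof.
move=> z z1; split=> // j; have [k ->|rj] := supportP j.
  by rewrite coord_of_phases_val normrM z1 mulr1 toC_norm ger0_norm.
by rewrite coord_of_phases_notin // rj normr0 rmorph0.
Qed.

Lemma phasesK : {in fibre Q ComplexScalars r, cancel phases of_phases}.
Proof.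
move=> v /set_mem[_ v_r]; apply: (coord_inj Q_unit) => j.
have [k ->|rj] := supportP j.
  by rewrite coord_of_phases_val mxE mulrC divfK ?toC_r_neq0.
rewrite coord_of_phases_notin //; apply/esym/eqP.
by rewrite -normr_eq0 v_r rj rmorph0.
Qed.

Lemma of_phasesK : cancel of_phases phases.
Proof.
move=> z; apply/matrixP => k l; rewrite ord1 mxE coord_of_phases_val.
by rewrite mulrC mulKf ?toC_r_neq0.
Qed.

Lemma phases_continuous : continuous phases.
Proof.
apply: continuous_mx => k l; rewrite (_ : (fun _ => _) =
    (fun x => x * (toC (r (enum_val k)))^-1) \o
    (fun M : 'cV[Cplx R]_n => M (enum_val k) 0) \o
    (fun v => invmx Q *m v)); last by apply/funext => v; rewrite mxE.
move=> v; apply: continuous_comp; first exact: mulmx_continuous.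
by apply: continuous_comp; [exact: coord_continuous | exact: mulrr_continuous].
Qed.

Lemma of_phases_continuous : continuous of_phases.
Proof.
rewrite (_ : of_phases = mulmx (Q *m
    \matrix_(j, k) (toC (r j) *+ (j == enum_val k)))).
  exact: mulmx_continuous.
by apply/funext => z; rewrite -mulmxA.
Qed.
End ComplexFibre.

(** * The theorem *)

Lemma polyF_interlaces (R : realType) n (lam mu : n.-tuple R) :
  polyF lam mu <-> interlaces false lam mu.
Proof.
split=> lam_mu i j; have [lo up] := lam_mu i j.
  by split=> ij; [apply: lo|apply: up]; apply/eqP; rewrite ij addn0.
by split=> /eqP ij; [apply: lo|apply: up]; rewrite ij addn0.
Qed.

Lemma polyG_interlaces (R : realType) n (lam : n.-tuple R) (mu : (n + 1).-tuple R) :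
  polyG lam mu <-> interlaces true lam mu.
Proof.
split=> lam_mu i j; have [lo up] := lam_mu i j.
  by split=> ij; [apply: lo|apply: up]; apply/eqP; move: ij; rewrite (addn1 j) // => -[].
by split=> /eqP ij; [apply: lo|apply: up]; rewrite (addn1 j) ij.
Qed.

Section Shape.
Context {R : realType} {n : nat}.
Variables (lam : n.-tuple R) (lam_lt : sorted <%O lam).

Definition radius m (mu : m.-tuple R) j : R :=
  Num.sqrt (weight (tnth lam) (nodal (tnth mu)) j).

Lemma radius_ge0 m (mu : m.-tuple R) j : 0 <= radius mu j.
Proof. exact: sqrtr_ge0. Qed.

(** The j-th radius vanishes exactly when the spectral polynomial vanishes at
lam_j, that is when lam_j occurs in mu. *)
Lemma card_radius (e : bool) m (mu : m.-tuple R) (faces : {set 'I_m * 'I_n}) :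
  m = (n + e)%N -> interlaces e lam mu ->
  (forall i j, ((i, j) \in faces) =
     ((i == j + e :> nat)%N || (i.+1 == j + e :> nat)%N) &&
     (tnth mu i == tnth lam j)) ->
  #|[pred j | (radius mu j != 0)%R]| = (n + repeats mu - #|faces|)%N.
Proof.
move=> mE lam_mu facesE.
rewrite (card_faces_repeats mE lam_lt lam_mu facesE); apply: eq_card => j.
rewrite !inE /radius sqrtr_eq0 -ltNge lt_neqAle.
rewrite (interlaces_weight_ge0 mE lam_lt lam_mu) andbT eq_sym /weight.
rewrite mulf_eq0 oppr_eq0 invr_eq0.
rewrite (negPf (prod_neq_sub_neq0 _ (node_inj lam_lt))) orbF -/(root _ _).
by rewrite /nodal -(big_tuple _ _ _ predT (fun x => 'X - x%:P)) root_prod_XsubC.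
Qed.
End Shape.

Lemma card_eq_setX1 T U (A : set T) (c : U) : A `*` [set c] #= A.
Proof.
have -> : A `*` [set c] = (fun a => (a, c)) @` A.
  apply/seteqP; split=> [[a _] [/= Aa ->]|_ [a Aa <-]]; first by exists a.
  by split.
by apply: inj_card_eq => a b _ _ [].
Qed.

Theorem theorem1p4 (R : realType) (n : nat) (K : scalars)
    (S Q : 'M[Cplx R]_n) (lam : n.-tuple R)
    (hS : S \is hermsymmx)
    (hlam : sigma_o S = lam)
    (lam_lt : sorted <%O lam)
    (hQ : is_eigenbasis S lam Q)
    (SK : forall i j, S i j \in entries R K)
    (QK : forall i j, Q i j \in entries R K) :
  let preF mu := Kvec R K n `&` hatF S @^-1` [set mu] in
  let preG mu := (Kvec R K n `*` [set: R]) `&` hatG S @^-1` [set mu] in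
  (orthant Q `<=` Kvec R K n /\
   set_fun (Kvec R K n) (orthant Q) (absQ Q) /\
   set_fun (orthant Q) (polyF lam) (hatF S) /\
   set_fun (orthant Q `*` [set: R]) (polyG lam) (hatG S) /\
   set_fun (Kvec R K n) (polyF lam) (hatF S) /\
   set_fun (Kvec R K n `*` [set: R]) (polyG lam) (hatG S) /\
   (forall v w, Kvec R K n v -> Kvec R K n w -> forall c : R,
      (hatF S v = hatF S w <-> hatG S (v, c) = hatG S (w, c)) /\
      (hatG S (v, c) = hatG S (w, c) <-> absQ Q v = absQ Q w)) /\
   (forall mu, polyF lam mu ->
      exists2 r : R, 0 <= r & preF mu `<=` sphere r) /\
   (forall mu, polyG lam mu ->
      exists2 r : R, 0 <= r & fst @` preG mu `<=` sphere r)) /\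
  (K = RealScalars ->
   (forall mu k, polyF lam mu -> #|faces_throughF lam mu| = k ->
      preF mu #= `I_(2 ^ (n + repeats mu - k))) /\
   (forall mu k, polyG lam mu -> #|faces_throughG lam mu| = k ->
      preG mu #= `I_(2 ^ (n + repeats mu - k)))) /\
  (K = ComplexScalars ->
   (forall mu k, polyF lam mu -> #|faces_throughF lam mu| = k ->
      homeomorphic (preF mu) (torus R (n + repeats mu - k))) /\
   (forall mu k, polyG lam mu -> #|faces_throughG lam mu| = k ->
      homeomorphic (preG mu) (torus R (n + repeats mu - k)))).
Proof.
move=> preF preG; have Q_unit := eigenbasis_unit hQ.
have preFE mu : polyF lam mu -> preF mu = fibre Q K (radius lam mu).
  move=> /polyF_interlaces lam_mu.
  have w_ge0 := interlaces_weight_ge0 (e := false) (esym (addn0 n)) lam_lt lam_mu.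
  apply/seteqP; split=> v [Kv].
    by move=> /(hatF_fibre hS hQ lam_lt _ lam_mu)/(sqcoord_eqP _ _ w_ge0).
  by move=> /(sqcoord_eqP _ _ w_ge0)/(hatF_fibre hS hQ lam_lt _ lam_mu).
have preGE mu : polyG lam mu ->
    preG mu = fibre Q K (radius lam mu) `*` [set corner lam mu].
  move=> /polyG_interlaces lam_mu.
  have w_ge0 := interlaces_weight_ge0 (e := true) erefl lam_lt lam_mu.
  apply/seteqP; split=> -[v c].
    case=> -[/= Kv _] /(hatG_fibre hS hQ lam_lt _ _ lam_mu)[].
    by move=> /(sqcoord_eqP _ _ w_ge0).
  case=> -[/= Kv v_r] c_mu; split=> //=.
  by apply/(hatG_fibre hS hQ lam_lt _ _ lam_mu); split=> //; apply/sqcoord_eqP.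
have cardF mu k : polyF lam mu -> #|faces_throughF lam mu| = k ->
    (n + repeats mu - k)%N = #|[pred j | (radius lam mu j != 0)%R]|.
  move=> /polyF_interlaces lam_mu <-; apply/esym.
  apply: (card_radius lam_lt _ lam_mu) => [|i j]; first by rewrite addn0.
  by rewrite !inE /lower_faceF /upper_faceF addn0.
have cardG mu k : polyG lam mu -> #|faces_throughG lam mu| = k ->
    (n + repeats mu - k)%N = #|[pred j | (radius lam mu j != 0)%R]|.
  move=> /polyG_interlaces lam_mu <-; apply/esym.
  apply: (card_radius lam_lt _ lam_mu) => [|i j] //.
  by rewrite !inE /lower_faceG /upper_faceG (addn1 j) eqSS.
have fibre_sphere r :
    fibre Q K r `<=` sphere (Num.sqrt (\sum_j r j ^+ 2)).
  move=> v [_ v_r]; rewrite /sphere /= (enormE hQ); congr Num.sqrt.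
  by apply: eq_bigr => j _; rewrite /sqcoord v_r toCK.
have hatF_poly v : polyF lam (hatF S v).
  by apply/polyF_interlaces; apply: hatF_interlaces hS hQ lam_lt v.
have hatG_poly vc : polyG lam (hatG S vc).
  by apply/polyG_interlaces; apply: hatG_interlaces hS hQ lam_lt vc.
split; [|split].
- split; first exact: orthant_Kvec.
  split; first by move=> v _; apply: absQ_orthant.
  split; first by move=> v _.
  split; first by move=> v _.
  split; first by move=> v _.
  split; first by move=> v _.
  split.
    move=> v w _ _ c; rewrite (hatG_eqP hS hQ lam_lt); split=> //.
    exact: hatF_eqP hS hQ lam_lt v w.
  split=> mu mu_poly; exists (Num.sqrt (\sum_j radius lam mu j ^+ 2));
    rewrite ?sqrtr_ge0 //.
    by rewrite preFE.
  by rewrite preGE // => _ [vc [+ _] <-]; apply: fibre_sphere.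
- move=> KR; have Q_real : forall i j, Q i j \in entries R RealScalars.
    by rewrite -KR.
  have card_fibre m (mu : m.-tuple R) :=
    card_fibre_real Q_unit (radius_ge0 lam mu) Q_real.
  split=> mu k mu_poly mu_k.
    by rewrite preFE // KR (cardF mu).
  rewrite preGE // KR (cardG mu) //.
  exact: card_eq_trans (card_eq_setX1 _ _) (card_fibre _ mu).
- move=> KC; split=> mu k mu_poly mu_k.
    rewrite preFE // KC (cardF mu) //.
    exists (phases Q (radius lam mu)), (@of_phases _ _ Q (radius lam mu)); split.
    + exact/phases_torus/radius_ge0.
    + exact/of_phases_fibre/radius_ge0.
    + exact: phasesK.
    + by move=> z _; apply: of_phasesK.
    + split; apply: continuous_subspaceT.
        exact: phases_continuous.
      exact: of_phases_continuous.
  rewrite preGE // KC (cardG mu) //.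
  exists (phases Q (radius lam mu) \o fst),
    (fun z => (@of_phases _ _ Q (radius lam mu) z, corner lam mu)); split.
  + by move=> [v c] [/= v_r _]; apply: phases_torus (radius_ge0 _ _) _ v_r.
  + by move=> z z1; split=> //; apply: of_phases_fibre (radius_ge0 _ _) _ z1.
  + by move=> [v c] /set_mem[/= v_r ->]; rewrite phasesK // inE.
  + by move=> z _; apply: of_phasesK.
  + split; apply: continuous_subspaceT.
      move=> x; apply: continuous_comp; first exact: cvg_fst.
      exact: phases_continuous.
    move=> z; apply: (cvg_pair (G := nbhs _) (H := nbhs _))
      (@of_phases_continuous R n Q (radius lam mu) z) _.
    exact: cvg_cst.
Qed.
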